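(* Let $X\subset\mathbb{R}^n$ be a closed and unbounded set, let $I=\{1,\ldots,m\}$, and let $f=(f_1,\ldots,f_m):\mathbb{R}^n\to\mathbb{R}^m$ be such that each $f_i:\mathbb{R}^n\to\mathbb{R}$, $i\in I$, is lower semicontinuous. If the following conditions are satisfied: (a) $\mathrm{Sol}^w(0)$ is a singleton, (b) $X^{\infty}\cap\big(\bigcup_{i\in I}\mathcal{K}(f_i)\big)=\{0\}$, then the set-valued mapping $\mathrm{Sol}^w(\cdot):\mathbb{R}^{m\times n}\rightrightarrows\mathbb{R}^n$ is lower semicontinuous at $0$.
   Context: All spaces are Euclidean. For $u=(u_1,\ldots,u_m)\in\mathbb{R}^{m\times n}$ with $u_i\in\mathbb{R}^n$, put $\|u\|:=\max_{i\in I}\|u_i\|$ and $f_i^{u_i}(x):=f_i(x)-\langle u_i,x\rangle$. $\mathrm{Sol}^w(u)$ is the set of weak Pareto solutions of minimizing $f^u:=(f_1^{u_1},\ldots,f_m^{u_m})$ over $X$, i.e., of all $\bar x\in X$ such that there is no $x\in X$ with $f_i^{u_i}(x)<f_i^{u_i}(\bar x)$ for all $i\in I$. Asymptotic cone: $X^\infty:=\{d\in\mathbb{R}^n:\exists\, t_k\to+\infty,\ \exists\, x_k\in X,\ x_k/t_k\to d\}$. Asymptotic function of $\varphi:\mathbb{R}^n\to\mathbb{R}$: $\varphi^\infty(d):=\inf\{\liminf_{k\to\infty}\varphi(t_kd_k)/t_k:\ t_k\to+\infty,\ d_k\to d\}$. $\mathcal{K}(\varphi):=\{d\in\mathbb{R}^n:\varphi^\infty(d)\le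 0\}$. A set-valued mapping $F$ is lower semicontinuous at $\bar u$ if $F(\bar u)\neq\emptyset$ and for every open set $V$ with $F(\bar u)\cap V\neq\emptyset$ there is a neighborhood $U$ of $\bar u$ such that $F(u)\cap V\neq\emptyset$ for all $u\in U$. *)

(* Defs.v *)
From mathcomp Require Import all_boot all_order all_algebra.
From mathcomp Require Import all_classical all_reals all_analysis.

Set Implicit Arguments.
Unset Strict Implicit.
Unset Printing Implicit Defensive.

Import Order.TTheory GRing.Theory Num.Theory.
Import numFieldNormedType.Exports.

Local Open Scope classical_set_scope.
Local Open Scope ring_scope.

(* R^n is 'rV[R]_n and R^(m x n) is 'M[R]_(m, n), whose i-th row is u_i. Their
   library norm is the maximum of the absolute values of the entries; it is
   equivalent to the Euclidean norm on R^n and to max_i |u_i| (Euclidean |u_i|)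
   on R^(m x n), so neighbourhoods, limits, closed sets and bounded sets are the
   same for either choice of norm. *)

Section Defs.
Context {R : realType}.

Definition inner_prod n (x y : 'rV[R]_n) : R := \sum_(j < n) x 0 j * y 0 j.

Definition tilt m n (f : 'I_m -> 'rV[R]_n -> R) (u : 'M[R]_(m, n))
    (i : 'I_m) (x : 'rV[R]_n) : R :=
  f i x - inner_prod (row i u) x.

Definition weak_pareto m n (X : set 'rV[R]_n) (g : 'I_m -> 'rV[R]_n -> R) :
    set 'rV[R]_n :=
  [set xbar | X xbar /\ ~ (exists2 x, X x & forall i, g i x < g i xbar)].

Definition Solw m n (X : set 'rV[R]_n) (f : 'I_m -> 'rV[R]_n -> R)
    (u : 'M[R]_(m, n)) : set 'rV[R]_n :=
  weak_pareto X (tilt f u).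

(* As t_k -> +oo, the finitely many k with t_k = 0, where division returns 0,
   do not affect the limits in the next two definitions. *)
Definition asymptotic_cone n (X : set 'rV[R]_n) : set 'rV[R]_n :=
  [set d | exists (t : nat -> R) (x : nat -> 'rV[R]_n),
    [/\ t k @[k --> \oo] --> +oo,
        (forall k, X (x k)) &
        (t k)^-1 *: x k @[k --> \oo] --> d]].

Definition asymptotic_fun n (phi : 'rV[R]_n -> R) (d : 'rV[R]_n) : \bar R :=
  ereal_inf [set l | exists (t : nat -> R) (e : nat -> 'rV[R]_n),
    [/\ t k @[k --> \oo] --> +oo,
        e k @[k --> \oo] --> d &
        l = limn_einf (fun k => (phi (t k *: e k) / t k)%:E)]].

Definition Kset n (phi : 'rV[R]_n -> R) : set 'rV[R]_n :=
  [set d | (asymptotic_fun phi d <= 0)%E].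

End Defs.

Definition setvalued_lsc_at (S T : topologicalType) (F : S -> set T) (s : S) :=
  F s !=set0 /\
  forall V : set T, open V -> F s `&` V !=set0 ->
    \forall s' \near s, F s' `&` V !=set0.

(* Main.v *)
Require Import Defs.
From mathcomp Require Import all_boot all_order all_algebra.
From mathcomp Require Import all_classical all_reals all_analysis.
From mathcomp Require Import lra.

Import Order.TTheory GRing.Theory Num.Theory.
Import numFieldNormedType.Exports.

Local Open Scope classical_set_scope.
Local Open Scope ring_scope.

Set Implicit Arguments.
Unset Strict Implicit.

(** A minimizer over X of a single component is a weak Pareto solution, and one
    component suffices for the whole theorem. Condition (b) puts 0 in some
    K(f_i), so an index i exists; fix it. For this i, (b) says that no nonzero
    asymptotic direction of X lies in K(f_i), and a compactness argument on the
    unit sphere turns this into linear coercivity of f_i on X: f_i(x) >= c |x|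
    for x in X far from 0 ([asymptotic_coercive]). By lower semicontinuity, f_i
    then has a minimizer on X; minimizers of f_i belong to Sol^w(0), so by (a)
    the minimizer is unique, namely the only point xbar of Sol^w(0).

    Uniqueness and coercivity together give a growth condition off every ball
    of radius e around xbar ([unique_minimizer_growth]):
      f_i(x) >= f_i(xbar) + k (1 + |x - xbar|)   for x in X, |x - xbar| >= e.
    Tilting f_i by u changes f_i(x) - f_i(xbar) by at most n |u| |x - xbar|,
    which is absorbed by the right-hand side as soon as n |u| < k. Hence outside
    the ball the tilted function stays above its value at xbar, so that its
    minimum over the compact part of X in the closed ball is a minimum over all
    of X ([local_minimizer]). For all small u this yields an element of
    Sol^w(u) within distance e of xbar, which is lower semicontinuity. *)

(** * Lower semicontinuous functions and their minimizers *)

Definition minimizers {T : Type} {R : realType} (C : set T) (phi : T -> R) :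
    set T :=
  [set x | C x /\ forall y, C y -> phi x <= phi y].

(** The sublevel sets of phi at its values on K generate a proper filter on K.
    A cluster point of it is a minimizer: if some y had phi y < phi x,
    semicontinuity would separate x from the sublevel set at phi y. *)
Lemma compact_lsc_minimizer (R : realType) (T : topologicalType) (K : set T)
    (phi : T -> R) :
  compact K -> K !=set0 -> lower_semicontinuous (fun x => (phi x)%:E) ->
  minimizers K phi !=set0.
Proof.
move=> Kc [x0 Kx0] lsc.
pose F := filter_from K (fun y => [set x | K x /\ phi x <= phi y]).
have FF : ProperFilter F.
  apply: filter_from_proper => [|y Ky]; last by exists y; split.
  apply: filter_from_filter; first by exists x0.
  move=> y z Ky Kz; have [yz|/ltW zy] := leP (phi y) (phi z).
    by exists y => // x [Kx xy]; split; split=> //; apply: le_trans yz.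
  by exists z => // x [Kx xz]; split; split=> //; apply: le_trans zy.
have [|x [Kx Fx]] := Kc F FF; first by exists x0 => // x [].
exists x; split=> // y Ky; rewrite leNgt; apply/negP => yx.
have [V Vx yV] := lsc x (phi y) yx.
have Fy : F [set x | K x /\ phi x <= phi y] by exists y.
have [z [[_ zy] /yV]] := Fx _ _ Fy Vx.
by rewrite lte_fin ltNge zy.
Qed.

Lemma lscB (T : topologicalType) (R : realType) (phi g : T -> R) :
  lower_semicontinuous (fun x => (phi x)%:E) -> continuous g ->
  lower_semicontinuous (fun x => (phi x - g x)%:E).
Proof.
move=> lsc cg x a; rewrite lte_fin => ax.
pose e := (phi x - g x - a) / 2.
have e0 : 0 < e by rewrite /e; lra.
have [|V Vx phiV] := lsc x (phi x - e); first by rewrite lte_fin; lra.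
have gx : \forall y \near x, `|g x - g y| < e.
  exact: cvgr_dist_lt (cg x) _ e0.
exists (V `&` [set y | `|g x - g y| < e]); first exact: filterI.
move=> y [/phiV +]; rewrite /= !lte_fin ltr_norml => phiy /andP[gy _].
by rewrite /e in gy phiy *; lra.
Qed.

(** * Norm and inner product on row vectors *)

Lemma dist_continuous (R : realType) (V : normedModType R) (a : V) :
  continuous (fun x : V => `|x - a|).
Proof.
by move=> x; apply: cvg_norm; apply: cvgB; [exact: cvg_id|exact: cvg_cst].
Qed.

Lemma closedball_set_compact (R : realType) n (C : set 'rV[R]_n)
    (a : 'rV[R]_n) r :
  closed C -> compact (C `&` [set x | `|x - a| <= r]).
Proof.
move=> Ccl; apply: bounded_closed_compact.
  exists (r + `|a|); split; first exact: num_real.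
  move=> M /ltW rM x [_ /= xr]; apply: le_trans rM.
  by rewrite -[x](subrK a) (le_trans (ler_normD _ _))// lerD2r.
apply: closedI => //.
have -> : [set x | `|x - a| <= r] = (fun x => `|x - a|) @^-1` [set t | t <= r].
  by [].
apply: closed_comp; last exact: closed_le.
by move=> x _; exact: (@dist_continuous R 'rV[R]_n).
Qed.

Lemma lincomb_continuous (R : realType) (T : topologicalType) (I : Type)
    (s : seq I) (a : I -> R) (F : I -> T -> R) :
  (forall i, continuous (F i)) ->
  continuous (fun x => \sum_(i <- s) a i * F i x).
Proof.
move=> cF; elim: s => [|i s IHs].
  rewrite (_ : (fun x => _) = cst 0); first exact: cst_continuous.
  by apply/funext => x; rewrite big_nil.
rewrite (_ : (fun x => _) =
  (fun x => a i * F i x + \sum_(j <- s) a j * F j x)); last first.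
  by apply/funext => x; rewrite big_cons.
move=> x; apply: cvgD; last exact: IHs.
by apply: cvgM; [exact: cvg_cst|exact: cF].
Qed.

Section inner_prod.
Context {R : realType} {n : nat}.
Implicit Types x y v : 'rV[R]_n.

Lemma le_coord_norm m (A : 'M[R]_(m, n)) i j : `|A i j| <= `|A|.
Proof.
rewrite [leRHS]/Num.norm /= mx_normrE; apply/bigmax_geP; right => /=.
by exists (i, j).
Qed.

Lemma inner_prodBr v x y :
  inner_prod v (x - y) = inner_prod v x - inner_prod v y.
Proof.
rewrite /inner_prod -sumrB; apply: eq_bigr => j _.
by rewrite !mxE mulrBr.
Qed.

(** The factor n appears because the norms are entrywise maxima. *)
Lemma inner_prod_row_le m (u : 'M[R]_(m, n)) i x :
  `|inner_prod (row i u) x| <= n%:R * `|u| * `|x|.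
Proof.
apply: (le_trans (ler_norm_sum _ _ _)).
apply: (@le_trans _ _ (\sum_(j < n) `|u| * `|x|)); last first.
  by rewrite sumr_const card_ord -mulrA mulr_natl.
apply: ler_sum => j _; rewrite normrM mxE.
by apply: ler_pM => //; exact: le_coord_norm.
Qed.

Lemma inner_prod_continuous v : continuous (inner_prod v).
Proof.
apply: (@lincomb_continuous R 'rV[R]_n) => j.
exact: (@coord_continuous R 1 n 0 j).
Qed.

End inner_prod.

(** * Coercivity from the asymptotic cone *)

(** Membership in K(phi) is an inequality on an infimum of lower limits, so one
    sequence with quotients dominated by a null sequence certifies it. *)
Lemma Kset_vanishing_bound (R : realType) n (phi : 'rV[R]_n -> R)
    (t : nat -> R) (e : nat -> 'rV[R]_n) (b : nat -> R) d :
  t k @[k --> \oo] --> +oo -> e k @[k --> \oo] --> d ->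
  b k @[k --> \oo] --> (0 : R) ->
  (forall k, phi (t k *: e k) / t k <= b k) ->
  Kset phi d.
Proof.
move=> toy ed b0 phib.
apply: (@le_trans _ _ (limn_einf (fun k => (phi (t k *: e k) / t k)%:E))).
  by apply: ereal_inf_lbound; exists t, e.
have b0E : (b k)%:E @[k --> \oo] --> 0%E by apply: cvg_EFin => //; exact: nearW.
rewrite -(cvg_limn_einf_sup b0E).1 !limn_einf_lim.
apply: lee_lim; [exact: is_cvg_einfs|exact: is_cvg_einfs|].
apply: nearW => k; apply: le_ereal_inf_tmp => _ /= [l kl <-].
apply: (@le_trans _ _ (phi (t l *: e l) / t l)%:E); last by rewrite lee_fin.
by apply: ereal_inf_lbound; exists l.
Qed.

(** Around each unit direction d there must be a level k beyond which
    phi(x) >= |x| / (k+1) for the x in X pointing close to d: otherwise a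
    sequence x_k in X, with norms tending to infinity and directions tending to
    d, would witness that d is both asymptotic for X and in K(phi). Compactness
    of the unit sphere makes the level uniform in d. *)
Lemma asymptotic_coercive (R : realType) n (X : set 'rV[R]_n)
    (phi : 'rV[R]_n -> R) :
  asymptotic_cone X `&` Kset phi `<=` [set 0] ->
  exists2 c, 0 < c &
    exists r, forall x, X x -> r <= `|x| -> c * `|x| <= phi x.
Proof.
move=> XK0.
pose S : set 'rV[R]_n := [set d | `|d| = 1].
have Sc : compact S.
  have -> : S = [set d | `|d| = 1] `&` [set d | `|d - 0| <= 1].
    by apply/seteqP; split=> d /=; rewrite subr0; [move=> ->|case].
  apply: closedball_set_compact.
  rewrite (_ : [set d | _] = (fun d : 'rV[R]_n => `|d|) @^-1` [set 1])//.
  apply: closed_comp; last exact: closed_eq.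
  by move=> d _; exact: norm_continuous.
pose P (k : nat) (d : 'rV[R]_n) :=
  forall x, X x -> k.+1%:R <= `|x| -> `|x|^-1 *: x = d ->
    k.+1%:R^-1 * `|x| <= phi x.
(* The bound weakens as k grows, so the levels obtained at different directions
   are compatible, and the near-covering form of compactness applies. *)
have [k _ kP] : \forall k \near \oo, S `<=` P k.
  move/compact_near_coveringP : Sc; apply => d /= d1.
  suff [k kP] : exists k, forall x, X x -> k.+1%:R <= `|x| ->
      `|d - `|x|^-1 *: x| < k.+1%:R^-1 -> k.+1%:R^-1 * `|x| <= phi x.
    exists ([set d' | `|d - d'| < k.+1%:R^-1], [set l | (k <= l)%N]).
      split; last by exists k.
      by apply/(@nbhs_normP R 'rV[R]_n); exists k.+1%:R^-1 => //=.
    move=> [d' l] [/= dd' kl] x Xx lx xd'.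
    have kl1 : k.+1%:R <= l.+1%:R :> R by rewrite ler_nat.
    apply: (@le_trans _ _ (k.+1%:R^-1 * `|x|)).
      by rewrite ler_wpM2r// lef_pV2// posrE ltr0n.
    by apply: kP; [|exact: le_trans lx|rewrite xd'].
  apply: contrapT => /forallNP nk.
  have /choice[x xP] : forall k, exists x, [/\ X x, k.+1%:R <= `|x|,
      `|d - `|x|^-1 *: x| < k.+1%:R^-1 & phi x < k.+1%:R^-1 * `|x|].
    move=> k; apply: contrapT => /forallNP nx; apply: (nk k) => x Xx kx dx.
    by rewrite leNgt; apply/negP => phix; exact: (nx x).
  have x0 k : 0 < `|x k|.
    by have [_ /(lt_le_trans _) + _ _] := xP k; apply; rewrite ltr0n.
  have xoo : `|x k| @[k --> \oo] --> +oo.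
    apply: (@ger_cvgy _ _ _ _ (fun k => k%:R)); last exact: cvgr_idn.
    near=> k; have [_ + _ _] := xP k; apply: le_trans.
    by rewrite ler_nat.
  have xd : `|x k|^-1 *: x k @[k --> \oo] --> d.
    apply/cvgrPdist_lt => e e0.
    have /cvgrPdist_lt/(_ _ e0) := @cvg_harmonic R; apply: filterS => k.
    rewrite sub0r normrN ger0_norm ?harmonic_ge0//; apply: lt_trans.
    by have [] := xP k.
  have d0 : d = 0.
    apply: XK0; split.
      by exists (fun k => `|x k|), x; split=> // k; case: (xP k).
    apply: (Kset_vanishing_bound xoo xd (@cvg_harmonic R)) => k.
    rewrite scalerA divff ?gt_eqF// scale1r ler_pdivrMr//.
    by have [_ _ _ /ltW] := xP k.
  by move: d1; rewrite /S /= d0 normr0 => /esym/eqP; rewrite oner_eq0.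
exists k.+1%:R^-1; first by rewrite invr_gt0 ltr0n.
exists k.+1%:R => x Xx kx; apply: (kP k (leqnn k) (`|x|^-1 *: x)) => //=.
have x0 : 0 < `|x| by apply: lt_le_trans kx; rewrite ltr0n.
by rewrite /S /= normrZ normfV normr_id mulVf// gt_eqF.
Unshelve. all: by end_near. Qed.

(** * Existence, uniqueness and growth *)

(** If phi exceeds phi x0 on X outside a closed ball around x0, the minimum over
    the compact part of X inside the ball, being at most phi x0, is global. *)
Lemma local_minimizer (R : realType) n (X : set 'rV[R]_n)
    (phi : 'rV[R]_n -> R) (x0 : 'rV[R]_n) r :
  closed X -> lower_semicontinuous (fun x => (phi x)%:E) ->
  X x0 -> (forall x, X x -> r < `|x - x0| -> phi x0 < phi x) -> 0 <= r ->
  minimizers X phi `&` [set x | `|x - x0| <= r] !=set0.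
Proof.
move=> Xcl lsc Xx0 far r0.
have Kx0 : X x0 /\ `|x0 - x0| <= r by rewrite subrr normr0.
have [|x [[Xx xr] xmin]] :=
  compact_lsc_minimizer (closedball_set_compact (a := x0) (r := r) Xcl) _ lsc.
  by exists x0.
exists x; split=> //; split=> // y Xy; have [yr|/far ry] := leP (`|y - x0|) r.
  exact: xmin.
by rewrite ltW// (le_lt_trans (xmin _ Kx0))// ry.
Qed.

Lemma coercive_minimizer (R : realType) n (X : set 'rV[R]_n)
    (phi : 'rV[R]_n -> R) (x0 : 'rV[R]_n) c r :
  closed X -> lower_semicontinuous (fun x => (phi x)%:E) -> X x0 ->
  0 < c -> (forall x, X x -> r <= `|x| -> c * `|x| <= phi x) ->
  minimizers X phi !=set0.
Proof.
move=> Xcl lsc Xx0 c0 coer.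
(* For |x - x0| > rho, the bound r + |x0| makes coercivity available and the
   bound |x0| + phi x0 / c makes c * |x| exceed phi x0. *)
pose rho := Num.max 0 (Num.max (r + `|x0|) (`|x0| + phi x0 / c)).
have [] := @local_minimizer R n X phi x0 rho Xcl lsc Xx0.
- move=> x Xx; rewrite /rho !gt_max => /and3P[_ rx bx].
  have xx0 : `|x - x0| <= `|x| + `|x0| by exact: ler_normB.
  apply: lt_le_trans (coer x Xx _); last by lra.
  by rewrite mulrC -ltr_pdivrMr//; lra.
- by rewrite le_max lexx.
- by move=> x [xmin _]; exists x.
Qed.

(** Far from x0 the growth comes from coercivity with half of its slope, the
    other half paying for the constants. In the remaining bounded region
    outside the ball of radius e, which is compact, phi attains a minimum; by
    uniqueness it is larger than phi x0, and 1 + |x - x0| is bounded there. The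
    summand 1 is what makes a perturbation of size k * |x - x0| harmless with a
    strict inequality. *)
Lemma unique_minimizer_growth (R : realType) n (X : set 'rV[R]_n)
    (phi : 'rV[R]_n -> R) (x0 : 'rV[R]_n) c r e :
  closed X -> lower_semicontinuous (fun x => (phi x)%:E) ->
  minimizers X phi = [set x0] ->
  0 < c -> (forall x, X x -> r <= `|x| -> c * `|x| <= phi x) -> 0 < e ->
  exists2 k, 0 < k & forall x, X x -> e <= `|x - x0| ->
    phi x0 + k * (1 + `|x - x0|) <= phi x.
Proof.
move=> Xcl lsc minE c0 coer e0.
have [Xx0 x0min] : minimizers X phi x0 by rewrite minE.
(* Beyond distance rho, |x| >= r and
   c |x| - phi x0 >= (c / 2) (1 + |x| + |x0|). *)
pose rho := Num.max (r + `|x0|) (2 * `|x0| + 1 + 2 * (phi x0 / c)).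
have far x : X x -> rho < `|x - x0| ->
    phi x0 + c / 2 * (1 + `|x - x0|) <= phi x.
  move=> Xx; rewrite /rho gt_max => /andP[rx bx].
  have xx0 : `|x - x0| <= `|x| + `|x0| by exact: ler_normB.
  have rlex : r <= `|x| by lra.
  apply: le_trans (coer x Xx rlex).
  have : c * (phi x0 / c) = phi x0 by rewrite mulrCA divff ?mulr1// gt_eqF.
  move: (phi x0 / c) bx => q bx <-.
  by rewrite mulrAC -mulrA -mulrDr ler_pM2l//; lra.
pose A := X `&` [set x | e <= `|x - x0|].
have Acl : closed A.
  apply: closedI => //.
  rewrite (_ : [set x | _] = (fun x => `|x - x0|) @^-1` [set t | e <= t])//.
  apply: closed_comp; last exact: closed_ge.
  by move=> x _; exact: (@dist_continuous R 'rV[R]_n).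
have [[x1 Ax1]|/forallNP A0] :=
  pselect (A `&` [set x | `|x - x0| <= rho] !=set0); last first.
  exists (c / 2); first by rewrite divr_gt0.
  move=> x Xx ex; have [xrho|] := leP (`|x - x0|) rho; last exact: far.
  by exfalso; apply: (A0 x).
have [|y [[[Xy ey] _] ymin]] :=
  compact_lsc_minimizer (closedball_set_compact (a := x0) (r := rho) Acl) _ lsc.
  by exists x1.
have gap : 0 < phi y - phi x0.
  rewrite subr_gt0 ltNge; apply/negP => yx0.
  have yE : y = x0.
    have : minimizers X phi y.
      by split=> // z Xz; apply: le_trans yx0 _; exact: x0min.
    by rewrite minE.
  by move: ey; rewrite /= yE subrr normr0 leNgt e0.
have rho0 : 0 < 1 + rho.
  by case: Ax1 => _ /= x1rho; have := normr_ge0 (x1 - x0); lra.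
exists (Num.min (c / 2) ((phi y - phi x0) / (1 + rho))).
  by rewrite lt_min !divr_gt0.
move=> x Xx ex; have x10 : 0 <= 1 + `|x - x0| by rewrite addr_ge0.
have [xrho|rhox] := leP (`|x - x0|) rho.
  apply: le_trans (ymin x _); last by [].
  rewrite -lerBrDl (@le_trans _ _ ((phi y - phi x0) / (1 + rho) * (1 + rho)))//.
    apply: ler_pM => //; last by rewrite lerD2l.
      by rewrite le_min !divr_ge0// ltW.
    by rewrite ge_min lexx orbT.
  by rewrite divfK// gt_eqF.
apply: le_trans (far x Xx rhox); rewrite lerD2l ler_wpM2r//.
by rewrite ge_min lexx.
Qed.

(** * Stability of weak Pareto solutions *)

Lemma minimizers_weak_pareto (R : realType) m n (X : set 'rV[R]_n)
    (g : 'I_m -> 'rV[R]_n -> R) i :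
  minimizers X (g i) `<=` weak_pareto X g.
Proof.
move=> x [Xx xmin]; split=> // -[y Xy /(_ i)].
by rewrite ltNge xmin.
Qed.

Theorem theorem4p2 (R : realType) (m n : nat) (X : set 'rV[R]_n)
    (f : 'I_m -> 'rV[R]_n -> R)
    (X_closed : closed X)
    (X_unbounded : ~ bounded_set X)
    (f_lsc : forall i : 'I_m, lower_semicontinuous (fun x => (f i x)%:E))
    (Sol0_singleton : exists xbar : 'rV[R]_n, Solw X f 0 = [set xbar])
    (cone_cond : asymptotic_cone X `&` \bigcup_(i in [set: 'I_m]) Kset (f i)
                 = [set 0]) :
  setvalued_lsc_at (Solw X f) 0.
Proof.
have [xbar SolE] := Sol0_singleton.
(* An index exists since 0 lies in the right-hand side of the cone condition. *)
have [i _] : (\bigcup_(i in [set: 'I_m]) Kset (f i)) 0.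
  by have [] : (asymptotic_cone X `&` \bigcup_(i in [set: 'I_m]) Kset (f i)) 0
    by rewrite cone_cond.
move=> _.
have [c c0 [r coer]] : exists2 c, 0 < c &
    exists r, forall x, X x -> r <= `|x| -> c * `|x| <= f i x.
  apply: asymptotic_coercive => d [Xd Kd].
  by rewrite -cone_cond; split=> //; exists i.
have Xxbar : X xbar by have [] : Solw X f 0 xbar by rewrite SolE.
have tilt0 x : tilt f 0 i x = f i x.
  suff : inner_prod (row i (0 : 'M[R]_(m, n))) x = 0.
    by rewrite /tilt => ->; rewrite subr0.
  by rewrite /inner_prod big1// => j _; rewrite !mxE mul0r.
have min_sub : minimizers X (f i) `<=` [set xbar].
  rewrite -SolE => x [Xx xmin].
  apply: (@minimizers_weak_pareto R m n X (tilt f 0) i).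
  by split=> // y Xy; rewrite !tilt0 xmin.
have minE : minimizers X (f i) = [set xbar].
  have [x xm] := coercive_minimizer X_closed (f_lsc i) Xxbar c0 coer.
  by apply/seteqP; split=> // _ ->; rewrite -(min_sub _ xm).
split; first by exists xbar; rewrite SolE.
move=> V Vo; rewrite SolE => -[_ [-> Vxbar]].
have [e e0 eV] : exists2 e, 0 < e & forall x, `|x - xbar| <= e -> V x.
  have /(@nbhs_normP R 'rV[R]_n)[d /= d0 dV] : nbhs xbar V.
    exact: open_nbhs_nbhs.
  exists (d / 2); first by rewrite divr_gt0.
  move=> x xd; apply: dV; rewrite /= distrC (le_lt_trans xd)//.
  by rewrite ltr_pdivrMr// mulr_natr mulr2n ltrDl.
have [k k0 growth] :=
  unique_minimizer_growth X_closed (f_lsc i) minE c0 coer e0.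
have : \forall u \near (0 : 'M[R]_(m, n)), n%:R * `|u| < k.
  apply/(@nbhs_normP R 'M[R]_(m, n)); exists (k / n.+1%:R).
    by rewrite /= divr_gt0// ltr0n.
  move=> u; rewrite /= sub0r normrN ltr_pdivlMr ?ltr0n// mulrC.
  apply: le_lt_trans.
  by rewrite ler_wpM2r// ler_nat.
apply: filterS => u uk.
have [x [xmin xe]] :
    minimizers X (tilt f u i) `&` [set x | `|x - xbar| <= e] !=set0.
  (* Growth off the ball dominates the tilt, so xbar beats every far point. *)
  apply: local_minimizer => //; last exact: ltW.
    by apply: lscB => //; exact: inner_prod_continuous.
  move=> x Xx /ltW ex.
  have := growth x Xx ex.
  have := inner_prod_row_le u i (x - xbar).
  rewrite inner_prodBr ler_norml => /andP[_]; rewrite /tilt.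
  have := normr_ge0 (x - xbar).
  nra.
exists x; split; first exact: (@minimizers_weak_pareto R m n X (tilt f u) i).
exact: eV.
Qed.
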